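(* For every integer $N\ge1$, \[t\left(3,\{2\}^N\right)=\frac{1}{2^{2N+2}}\left[\sum_{j=1}^{N}\frac{(-1)^{j+1}(2j)\,\pi^{2N+2-2j}}{(2N+2-2j)!}\,\eta(2j+1)+(-1)^N\,2\,(2N+2)\left(1-2^{-2N-3}\right)\zeta(2N+3)\right].\]
   Context: Multiple $t$-values: for positive integers $i_1\ge2,i_2,\dots,i_k$, $t(i_1,\dots,i_k)=\sum_{n_1>n_2>\cdots>n_k\ge1,\ n_j\text{ odd}}\frac{1}{n_1^{i_1}\cdots n_k^{i_k}}$. $t(3,\{2\}^N)$ denotes $t(3,2,\dots,2)$ with $N$ entries equal to $2$. $\zeta$ is the Riemann zeta function and $\eta(m)=(1-2^{1-m})\zeta(m)$ is the Dirichlet eta function. *)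

(* Defs.v *)
From Stdlib Require Import Reals List ZArith.
From Coquelicot Require Import Coquelicot.
Open Scope R_scope.

(* The sum of 1 / (n_1^{i_1} ... n_k^{i_k}) over all odd n_j with
   M >= n_1 > n_2 > ... > n_k >= 1, where s = (i_1, ..., i_k).  The inner sum
   is bounded by n - 1, and sum_n_m f 1 0 is the empty sum. *)
Fixpoint mtv_trunc (s : list nat) (M : nat) : R :=
  match s with
  | nil => 1
  | i :: s' =>
      sum_n_m (fun n : nat =>
        if Nat.odd n then / INR n ^ i * mtv_trunc s' (n - 1) else 0) 1 M
  end.

(* The terms are nonnegative, so mtv_trunc s is nondecreasing and this limit is
   genuine for every s.  It is p_infty exactly when the series diverges, hence an
   equation mtv s = Finite x contains the convergence of the series. *)
Definition mtv (s : list nat) : Rbar := Lim_seq (mtv_trunc s).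

(* The Riemann zeta function at the integers m >= 2; Series has no meaning for
   the divergent cases m <= 1. *)
Definition zeta (m : nat) : R := Series (fun n : nat => / INR (n + 1) ^ m).

Definition eta (m : nat) : R := (1 - powerRZ 2 (1 - Z.of_nat m)) * zeta m.

(* Main.v *)
(* Let T_N(n) be the truncation of t({2}^N) to odd indices below 2n.  Iterating
   (sin^a)'' = a(a-1) sin^(a-2) - a^2 sin^a shows that the partial sums of
   t^(2N+1)/(2N+1)! = Sum_n T_N(n) c_n sin^(2n+1) t on [0, pi/2], with c_n the
   arcsine coefficients, leave a remainder R that is nonnegative, increasing and
   convex, with R(pi/2) -> 0.  Pair this expansion with (pi/2 - t) cot t, written
   as the trigonometric series 2 Sum_m sin(2mt).  By the Dirichlet kernel,
   c_n sin^(2n+1) contributes 1/(2n+1)^3, which gives t(3,{2}^N); repeated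
   integration by parts of t^(2N+1) (pi/2 - t) sin(2mt), summed over m, gives the
   eta and zeta values.  Two integrations by parts bound the m-th coefficient
   of R by a multiple of R(pi/2)/m^2, so its contribution vanishes in the limit. *)
Require Import Defs.
From Stdlib Require Import Reals List ZArith Lra Lia.
From Coquelicot Require Import Coquelicot.
Open Scope R_scope.

(** * Finite sums of reals and odd integers *)

(** The general facts are stated with the operations of an abstract structure; over R they leave
    goals that [ring] and [lra] can read. *)
Lemma sum_n_R_S (a : nat -> R) (n : nat) : sum_n a (S n) = sum_n a n + a (S n).
Proof. rewrite sum_Sn; reflexivity. Qed.

Lemma sum_n_R_scal (c : R) (a : nat -> R) (n : nat) :
  sum_n (fun k => c * a k) n = c * sum_n a n.
Proof. exact (sum_n_mult_l c a n). Qed.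

Lemma sum_n_R_first (a : nat -> R) (n : nat) :
  sum_n a (S n) = a O + sum_n (fun k => a (S k)) n.
Proof.
  unfold sum_n; rewrite sum_Sn_m by lia; rewrite sum_n_m_S; reflexivity.
Qed.

Lemma sum_n_R_ext (a b : nat -> R) (n : nat) :
  (forall k, a k = b k) -> sum_n a n = sum_n b n.
Proof. exact (sum_n_ext a b n). Qed.

Lemma sum_n_R_plus (a b : nat -> R) (n : nat) :
  sum_n (fun k => a k + b k) n = sum_n a n + sum_n b n.
Proof. exact (sum_n_plus a b n). Qed.

Lemma INR_odd_pos (n : nat) : 0 < INR (2 * n + 1).
Proof. apply lt_0_INR; lia. Qed.

Lemma INR_odd_S (n : nat) : INR (2 * S n + 1) = INR (2 * n + 1) + 2.
Proof. rewrite !plus_INR, !mult_INR, (S_INR n); simpl; ring. Qed.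

(** * Zeta and eta series *)

(** Telescoping against 1/m - 1/(m+1). The bound 2 also fixes the constant in [truncation_error]. *)
Lemma sum_inv_sq_le (n : nat) :
  sum_n (fun k => / INR (k + 1) ^ 2) n <= 2 - / INR (n + 1).
Proof.
  induction n as [|n IH].
  - rewrite sum_O; simpl; lra.
  - rewrite sum_n_R_S.
    assert (h : / INR (S n + 1) ^ 2 <= / INR (n + 1) - / INR (S n + 1)).
    { rewrite !plus_INR, S_INR; simpl (INR 1).
      pose proof (pos_INR n) as h0.
      apply Rminus_le_0.
      replace (_ - _) with (/ ((INR n + 1) * (INR n + 1 + 1) ^ 2)) by (field; lra).
      apply Rlt_le, Rinv_0_lt_compat; nra. }
    lra.
Qed.

(** Comparison with exponent 2, whose partial sums increase and are bounded. *)
Lemma ex_series_inv_pow (s : nat) (hs : (2 <= s)%nat) :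
  ex_series (fun n : nat => / INR (n + 1) ^ s).
Proof.
  assert (hp : forall k, 1 <= INR (k + 1)).
  { intros k; rewrite plus_INR; simpl; pose proof (pos_INR k); lra. }
  apply (@ex_series_le R_AbsRing R_CompleteNormedModule _
           (fun n : nat => / INR (n + 1) ^ 2)).
  - intros k; specialize (hp k).
    change (Rabs (/ INR (k + 1) ^ s) <= / INR (k + 1) ^ 2).
    rewrite Rabs_pos_eq by (apply Rlt_le, Rinv_0_lt_compat, pow_lt; lra).
    apply Rinv_le_contravar; [apply pow_lt; lra | apply Rle_pow; auto].
  - destruct (ex_finite_lim_seq_incr (sum_n (fun n : nat => / INR (n + 1) ^ 2)) 2) as [l hl].
    + intros n; rewrite sum_n_R_S.
      assert (0 < / INR (S n + 1) ^ 2); [|lra].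
      apply Rinv_0_lt_compat, pow_lt; specialize (hp (S n)); lra.
    + intros n; pose proof (sum_inv_sq_le n) as h.
      assert (0 < / INR (n + 1)); [|lra].
      apply Rinv_0_lt_compat; specialize (hp n); lra.
    + exists l; exact hl.
Qed.

Lemma is_series_zeta (s : nat) (hs : (2 <= s)%nat) :
  is_series (fun n : nat => / INR (n + 1) ^ s) (zeta s).
Proof. apply Series_correct, ex_series_inv_pow, hs. Qed.

(** Absolute convergence provides some sum [l]. Along partial sums of even length the alternating
    sum is the full sum minus twice its even denominators, which identifies [l] with [eta s]. *)
Lemma is_series_eta (s : nat) (hs : (2 <= s)%nat) :
  is_series (fun n : nat => (-1) ^ n * / INR (n + 1) ^ s) (eta s).
Proof.
  assert (hp : forall k, 0 < INR (k + 1)) by (intros k; apply lt_0_INR; lia).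
  destruct (ex_series_Rabs (fun n : nat => (-1) ^ n * / INR (n + 1) ^ s)) as [l hl].
  { apply ex_series_ext with (fun n : nat => / INR (n + 1) ^ s);
      [|apply ex_series_inv_pow, hs].
    intros n; rewrite Rabs_mult, pow_1_abs, Rmult_1_l, Rabs_pos_eq; trivial.
    apply Rlt_le, Rinv_0_lt_compat, pow_lt; auto. }
  (* Index 2K+1 covers the denominators 1, ..., 2K+2, whose even members are 2(k+1) for k <= K;
     taking out 2^s leaves a zeta partial sum up to K. *)
  assert (hsplit : forall K,
    sum_n (fun n : nat => (-1) ^ n * / INR (n + 1) ^ s) (2 * K + 1)
    = sum_n (fun n : nat => / INR (n + 1) ^ s) (2 * K + 1)
      - 2 / 2 ^ s * sum_n (fun n : nat => / INR (n + 1) ^ s) K :> R).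
  { assert (hhalf : forall K, / INR (2 * K + 1 + 1) ^ s = / 2 ^ s * / INR (K + 1) ^ s).
    { intros K; replace (2 * K + 1 + 1)%nat with (2 * (K + 1))%nat by lia.
      rewrite mult_INR, Rpow_mult_distr, Rinv_mult; reflexivity. }
    induction K as [|K IH].
    - change (2 * 0 + 1)%nat with 1%nat; rewrite !sum_n_R_S, !sum_O.
      specialize (hhalf 0%nat); simpl (2 * 0 + 1 + 1)%nat in hhalf.
      simpl (1 + 1)%nat; rewrite hhalf; simpl ((-1) ^ _); unfold Rdiv; ring.
    - specialize (hhalf (S K)).
      replace (2 * S K + 1)%nat with (S (S (2 * K + 1))) in hhalf |- * by lia.
      rewrite !sum_n_R_S, IH, hhalf.
      replace ((-1) ^ S (S (2 * K + 1))) with (-1).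
      2:{ replace (S (S (2 * K + 1))) with (S (2 * S K)) by lia.
          symmetry; apply pow_1_odd. }
      replace ((-1) ^ S (2 * K + 1)) with 1.
      2:{ replace (S (2 * K + 1)) with (2 * S K)%nat by lia.
          symmetry; apply pow_1_even. }
      unfold Rdiv; ring. }
  assert (hlim : is_lim_seq (fun K =>
     sum_n (fun n : nat => (-1) ^ n * / INR (n + 1) ^ s) (2 * K + 1)) (eta s)).
  { eapply is_lim_seq_ext; [intros K; symmetry; apply hsplit|].
    replace (Finite (eta s)) with (Finite (zeta s - 2 / 2 ^ s * zeta s)).
    2:{ f_equal; unfold eta.
        unfold Zminus; rewrite powerRZ_add, powerRZ_neg', <- pow_powerRZ by lra.
        simpl (powerRZ 2 1); unfold Rdiv; ring. }
    apply is_lim_seq_minus'.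
    - apply (is_lim_seq_subseq _ _ (fun K => 2 * K + 1)%nat);
        [apply eventually_subseq; intros; lia|].
      apply (is_series_zeta s hs).
    - apply (is_lim_seq_scal_l _ _ (Finite (zeta s))), (is_series_zeta s hs). }
  assert (hlim2 : is_lim_seq (fun K =>
     sum_n (fun n : nat => (-1) ^ n * / INR (n + 1) ^ s) (2 * K + 1)) l).
  { apply (is_lim_seq_subseq _ _ (fun K => 2 * K + 1)%nat);
        [apply eventually_subseq; intros; lia|].
    exact hl. }
  replace (eta s) with l; [exact hl|].
  apply is_lim_seq_unique in hlim; apply is_lim_seq_unique in hlim2.
  rewrite hlim in hlim2; injection hlim2; auto.
Qed.

(** * Truncated multiple t-values *)

Lemma mtv_trunc_step (i : nat) (s : list nat) (M : nat) :
  mtv_trunc (i :: s) (S M) = mtv_trunc (i :: s) M +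
    if Nat.odd (S M) then / INR (S M) ^ i * mtv_trunc s M else 0.
Proof.
  cbn [mtv_trunc]; rewrite sum_n_Sm by lia.
  replace (S M - 1)%nat with M by lia; reflexivity.
Qed.

Lemma mtv_trunc_nonneg (s : list nat) (M : nat) : 0 <= mtv_trunc s M.
Proof.
  revert M; induction s as [|i s IH]; intros M; [simpl; lra|].
  induction M as [|M IHM].
  - simpl; rewrite sum_n_m_zero by lia; apply Rle_refl.
  - rewrite mtv_trunc_step; destruct (Nat.odd (S M)); [|lra].
    apply Rplus_le_le_0_compat; [exact IHM|].
    apply Rmult_le_pos; [|apply IH].
    apply Rlt_le, Rinv_0_lt_compat, pow_lt, lt_0_INR; lia.
Qed.

Lemma mtv_trunc_incr (s : list nat) (M : nat) : mtv_trunc s M <= mtv_trunc s (S M).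
Proof.
  destruct s as [|i s]; [simpl; lra|].
  rewrite mtv_trunc_step; destruct (Nat.odd (S M)); [|lra].
  assert (0 <= / INR (S M) ^ i * mtv_trunc s M); [|lra].
  apply Rmult_le_pos; [|apply mtv_trunc_nonneg].
  apply Rlt_le, Rinv_0_lt_compat, pow_lt, lt_0_INR; lia.
Qed.

(** Of the two new indices 2n+1 and 2n+2 only the odd one contributes. *)
Lemma mtv_trunc_double_step (i : nat) (s : list nat) (n : nat) :
  mtv_trunc (i :: s) (2 * S n)
  = mtv_trunc (i :: s) (2 * n) + / INR (2 * n + 1) ^ i * mtv_trunc s (2 * n).
Proof.
  replace (2 * S n)%nat with (S (S (2 * n))) by lia.
  rewrite !mtv_trunc_step.
  replace (Nat.odd (S (S (2 * n)))) with false.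
  2:{ symmetry; replace (S (S (2 * n))) with (2 * S n)%nat by lia; apply Nat.odd_even. }
  replace (Nat.odd (S (2 * n))) with true.
  2:{ symmetry; replace (S (2 * n)) with (2 * n + 1)%nat by lia; apply Nat.odd_odd. }
  replace (S (2 * n)) with (2 * n + 1)%nat by lia; ring.
Qed.

(** Monotonicity makes [Lim_seq] a true limit in the extended reals, so a subsequence determines
    it. *)
Lemma mtv_eq_lim_even (s : list nat) (l : R) :
  is_lim_seq (fun K => mtv_trunc s (2 * S K)) l -> mtv s = Finite l.
Proof.
  intros h; unfold mtv.
  pose proof (Lim_seq_correct _ (ex_lim_seq_incr _ (mtv_trunc_incr s))) as hc.
  apply (is_lim_seq_subseq _ _ (fun K => 2 * S K)%nat) in hc;
    [|apply eventually_subseq; intros; lia].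
  apply is_lim_seq_unique in h; apply is_lim_seq_unique in hc.
  rewrite <- h; symmetry; exact hc.
Qed.

(* T_N(n): the odd indices are 1, 3, ..., 2n - 1. *)
Definition t_twos (N n : nat) : R := mtv_trunc (repeat 2%nat N) (2 * n).

Lemma mtv_trunc_even (i N K : nat) :
  mtv_trunc (i :: repeat 2%nat N) (2 * S K)
  = sum_n (fun n => / INR (2 * n + 1) ^ i * t_twos N n) K.
Proof.
  induction K as [|K IH]; rewrite mtv_trunc_double_step.
  - rewrite sum_O; simpl (mtv_trunc (_ :: _) (2 * 0)).
    rewrite sum_n_m_zero by lia; apply Rplus_0_l.
  - rewrite IH, sum_n_R_S; reflexivity.
Qed.

Lemma t_twos_nil (n : nat) : t_twos 0 n = 1.
Proof. reflexivity. Qed.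

Lemma t_twos_S_0 (N : nat) : t_twos (S N) 0 = 0.
Proof. unfold t_twos; simpl; rewrite sum_n_m_zero by lia; reflexivity. Qed.

Lemma t_twos_S_S (N n : nat) :
  t_twos (S N) (S n) = t_twos (S N) n + / INR (2 * n + 1) ^ 2 * t_twos N n.
Proof. apply mtv_trunc_double_step. Qed.

Lemma t_twos_nonneg (N n : nat) : 0 <= t_twos N n.
Proof. apply mtv_trunc_nonneg. Qed.

(** A crude bound, uniform in [n], suffices: it only multiplies a quantity that tends to 0. *)
Lemma t_twos_le (N n : nat) : t_twos N n <= 2 ^ N.
Proof.
  revert n; induction N as [|N IH]; intros n; [rewrite t_twos_nil; simpl; lra|].
  assert (h2 : 0 < 2 ^ N) by (apply pow_lt; lra).
  (* Strengthened for the induction on [n]: with x = 2n+1, 1/x^2 <= 2/x - 2/(x+2) telescopes, and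
     the bound is 0 at n = 0. *)
  assert (h : t_twos (S N) n <= 2 ^ N * (2 - 2 / INR (2 * n + 1))).
  { induction n as [|n IHn].
    - rewrite t_twos_S_0; simpl; lra.
    - rewrite t_twos_S_S.
      rewrite INR_odd_S.
      assert (h1 : 1 <= INR (2 * n + 1)) by (apply (le_INR 1); lia).
      set (x := INR (2 * n + 1)) in *.
      assert (hx : / x ^ 2 <= 2 / x - 2 / (x + 2)).
      { apply Rminus_le_0.
        replace (_ - _) with ((3 * x - 2) / (x ^ 2 * (x + 2))) by (field; lra).
        apply Rdiv_le_0_compat; nra. }
      assert (h0 : 0 < / x ^ 2) by (apply Rinv_0_lt_compat; nra).
      pose proof (IH n). pose proof (t_twos_nonneg N n). nra. }
  assert (0 < 2 / INR (2 * n + 1)) by (apply Rdiv_lt_0_compat; [lra|apply INR_odd_pos]).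
  simpl; nra.
Qed.

(** * Arcsine coefficients *)

(** The Taylor coefficients of arcsin u = Sum c_n u^(2n+1), given by the recurrence (2k+2)(2k+3)
    c_(k+1) = (2k+1)^2 c_k, the form in which they meet the second derivative of sin^(2n+1). *)
Fixpoint arcsin_coef (n : nat) : R :=
  match n with
  | O => 1
  | S k => arcsin_coef k * INR (2 * k + 1) ^ 2 / ((INR (2 * k + 1) + 1) * (INR (2 * k + 1) + 2))
  end.

Lemma arcsin_coef_pos (n : nat) : 0 < arcsin_coef n.
Proof.
  induction n as [|n IH]; cbn [arcsin_coef]; [lra|].
  pose proof (INR_odd_pos n).
  apply Rdiv_lt_0_compat; [|nra].
  apply Rmult_lt_0_compat; [exact IH|nra].
Qed.

(* (2n+1) c_n is the central binomial ratio (2n-1)!!/(2n)!!. *)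
Lemma arcsin_coef_le (n : nat) : (INR (2 * n + 1) * arcsin_coef n) ^ 2 * INR (2 * n + 1) <= 1.
Proof.
  induction n as [|n IH]; [simpl; lra|].
  rewrite INR_odd_S; cbn [arcsin_coef].
  pose proof (INR_odd_pos n) as hx; pose proof (arcsin_coef_pos n) as hc.
  set (x := INR (2 * n + 1)) in *; set (c := arcsin_coef n) in *.
  (* One step multiplies the left side by x(x+2)/(x+1)^2, which is at most 1. *)
  replace (_ * _) with ((x * c) ^ 2 * x * (x * (x + 2) / (x + 1) ^ 2)) by (field; lra).
  assert (h : x * (x + 2) / (x + 1) ^ 2 <= 1).
  { apply Rmult_le_reg_r with ((x + 1) ^ 2); [nra|].
    unfold Rdiv; rewrite Rmult_assoc, Rinv_l by nra; nra. }
  assert (0 <= x * (x + 2) / (x + 1) ^ 2) by (apply Rdiv_le_0_compat; nra).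
  assert (0 <= (x * c) ^ 2 * x) by (apply Rmult_le_pos; [apply pow2_ge_0|lra]).
  nra.
Qed.

(** The squared sequence is at most 1/(2n+1). This decay is what sends the remainder at pi/2 to
    0. *)
Lemma arcsin_coef_lim : is_lim_seq (fun n => INR (2 * n + 1) * arcsin_coef n) 0.
Proof.
  apply is_lim_seq_ext with (fun n => sqrt ((INR (2 * n + 1) * arcsin_coef n) ^ 2)).
  { intros n; apply sqrt_pow2, Rmult_le_pos; apply Rlt_le;
      [apply INR_odd_pos|apply arcsin_coef_pos]. }
  rewrite <- sqrt_0.
  apply is_lim_seq_continuous; [apply continuity_pt_sqrt; lra|].
  apply is_lim_seq_le_le_loc with (fun _ => 0) (fun n => / INR n).
  - exists 1%nat; intros n hn; split; [apply pow2_ge_0|].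
    assert (hn0 : 0 < INR n) by (apply lt_0_INR; lia).
    apply Rmult_le_reg_r with (INR n); [lra|]; rewrite Rinv_l by lra.
    apply Rle_trans with (2 := arcsin_coef_le n), Rmult_le_compat_l;
      [apply pow2_ge_0|apply le_INR; lia].
  - apply is_lim_seq_const.
  - apply (is_lim_seq_inv INR p_infty); [apply is_lim_seq_INR|discriminate].
Qed.

(** * Sine moments *)

(** Mean value theorem for g - f. It yields monotonicity and comparison bounds without integrals. *)
Lemma increment_le (f g f1 g1 : R -> R) (a b : R) :
  a <= b ->
  (forall t, is_derive f t (f1 t)) -> (forall t, is_derive g t (g1 t)) ->
  (forall t, a <= t <= b -> f1 t <= g1 t) ->
  f b - f a <= g b - g a.
Proof.
  intros hab hf hg hle.
  assert (hd : forall t, is_derive (fun u => g u - f u) t (g1 t - f1 t))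
    by (intros t; apply (is_derive_minus g f); auto).
  destruct (MVT_gen (fun u => g u - f u) a b (fun t => g1 t - f1 t)) as [c [hc e]].
  - intros t _; apply hd.
  - intros t _; apply continuity_pt_filterlim, (ex_derive_continuous (fun u => g u - f u)).
    eexists; apply hd.
  - rewrite Rmin_left, Rmax_right in hc by lra.
    specialize (hle c hc); nra.
Qed.

Lemma derive_continuous (f f1 : R -> R) (t : R) : is_derive f t (f1 t) -> continuous f t.
Proof. intros h; apply (ex_derive_continuous f); exists (f1 t); exact h. Qed.

(** The name refers to the eta-expanded function in goals left by [auto_derive], not to the
    Dirichlet eta function. *)
Lemma Derive_eta (f : R -> R) (t l : R) : is_derive f t l -> Derive (fun u : R => f u) t = l.
Proof. apply is_derive_unique. Qed.

Lemma is_derive_affine_mul (c t l : R) (f : R -> R) :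
  is_derive f t l -> is_derive (fun u => (c - u) * f u) t ((c - t) * l - f t).
Proof.
  intros h; auto_derive; [exists l; exact h|].
  rewrite (Derive_eta _ _ _ h); ring.
Qed.

Lemma is_derive_R_minus (f g : R -> R) (t k l : R) :
  is_derive f t k -> is_derive g t l -> is_derive (fun u => f u - g u) t (k - l).
Proof. exact (is_derive_minus f g t k l). Qed.

Lemma is_derive_eq (f : R -> R) (t k l : R) : is_derive f t k -> k = l -> is_derive f t l.
Proof. intros h e; rewrite <- e; exact h. Qed.

Lemma ex_RInt_cont (f : R -> R) (a b : R) : (forall t, continuous f t) -> ex_RInt f a b.
Proof. intros h; apply (ex_RInt_continuous f); intros; apply h. Qed.

Lemma RInt_lin (c d a b : R) (f g : R -> R) :
  (forall t, continuous f t) -> (forall t, continuous g t) ->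
  RInt (fun t => c * f t + d * g t) a b = c * RInt f a b + d * RInt g a b.
Proof.
  intros hf hg; apply is_RInt_unique.
  apply (is_RInt_plus (fun t => c * f t) (fun t => d * g t)).
  - apply (is_RInt_scal f), (RInt_correct f), ex_RInt_cont, hf.
  - apply (is_RInt_scal g), (RInt_correct g), ex_RInt_cont, hg.
Qed.

Lemma RInt_primitive (f f1 : R -> R) (a b : R) :
  (forall t, is_derive f t (f1 t)) -> (forall t, continuous f1 t) ->
  RInt f1 a b = f b - f a.
Proof.
  intros hd hc; apply is_RInt_unique, (is_RInt_derive f f1); auto.
Qed.

Lemma continuous_Rmult (f g : R -> R) (t : R) :
  continuous f t -> continuous g t -> continuous (fun u => f u * g u) t.
Proof. intros; apply (continuous_mult f g); assumption. Qed.

Lemma continuous_Rplus (f g : R -> R) (t : R) :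
  continuous f t -> continuous g t -> continuous (fun u => f u + g u) t.
Proof. intros; apply (continuous_plus f g); assumption. Qed.

Lemma continuous_Rminus (f g : R -> R) (t : R) :
  continuous f t -> continuous g t -> continuous (fun u => f u - g u) t.
Proof. intros; apply (continuous_minus f g); assumption. Qed.

Lemma continuous_sin_lin (x t : R) : continuous (fun u => sin (x * u)) t.
Proof. apply (ex_derive_continuous (fun u => sin (x * u))); auto_derive; trivial. Qed.

Lemma continuous_cos_lin (x t : R) : continuous (fun u => cos (x * u)) t.
Proof. apply (ex_derive_continuous (fun u => cos (x * u))); auto_derive; trivial. Qed.

Lemma continuous_affine (c t : R) : continuous (fun u => c - u) t.
Proof. apply (ex_derive_continuous (fun u => c - u)); auto_derive; trivial. Qed.

Definition sin_moment (f : R -> R) (x : R) : R :=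
  RInt (fun t => f t * sin (x * t)) 0 (PI / 2).

Lemma sin_moment_lin (c d x : R) (f g : R -> R) :
  (forall t, continuous f t) -> (forall t, continuous g t) ->
  sin_moment (fun t => c * f t + d * g t) x = c * sin_moment f x + d * sin_moment g x.
Proof.
  intros hf hg; unfold sin_moment; rewrite <- RInt_lin.
  - apply RInt_ext; intros; simpl; ring.
  - intros; apply continuous_Rmult; auto using continuous_sin_lin.
  - intros; apply continuous_Rmult; auto using continuous_sin_lin.
Qed.

Lemma sin_moment_ext (f g : R -> R) (x : R) :
  (forall t, f t = g t) -> sin_moment f x = sin_moment g x.
Proof. intros h; apply RInt_ext; intros; rewrite h; reflexivity. Qed.

(** Two integrations by parts at once: -f cos(xt)/x + f' sin(xt)/x^2 is a primitive of (f + f''/x^2)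
    sin(xt). The terms in f' vanish at both ends because the sine does. *)
Lemma sin_moment_parts (f f1 f2 : R -> R) (x : R) :
  (forall t, is_derive f t (f1 t)) -> (forall t, is_derive f1 t (f2 t)) ->
  (forall t, continuous f2 t) -> x <> 0 -> sin (x * (PI / 2)) = 0 ->
  sin_moment f x
  = (f 0 - cos (x * (PI / 2)) * f (PI / 2)) / x - sin_moment f2 x / x ^ 2.
Proof.
  intros h1 h2 hc hx hs.
  assert (hf : forall t, continuous f t) by (intros t; apply (derive_continuous f f1), h1).
  assert (e : RInt (fun t => 1 * (f t * sin (x * t)) + / x ^ 2 * (f2 t * sin (x * t))) 0 (PI / 2)
     = (f 0 - cos (x * (PI / 2)) * f (PI / 2)) / x :> R).
  { rewrite (RInt_primitive
      (fun t => - f t * cos (x * t) / x + f1 t * sin (x * t) / x ^ 2)).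
    - rewrite hs, !Rmult_0_r, cos_0, sin_0; field; exact hx.
    - intros t; auto_derive.
      + repeat split; [exists (f1 t); apply h1 | exists (f2 t); apply h2].
      + rewrite (Derive_eta _ _ _ (h1 t)), (Derive_eta _ _ _ (h2 t)).
        field; exact hx.
    - intros t; apply continuous_Rplus; apply continuous_Rmult;
        auto using continuous_const, continuous_Rmult, continuous_sin_lin. }
  rewrite RInt_lin in e by (intros; apply continuous_Rmult; auto using continuous_sin_lin).
  fold (sin_moment f x) (sin_moment f2 x) in e.
  rewrite <- e; field; exact hx.
Qed.

(** Dividing by n! makes differentiation lower the index with no factor. *)
Definition mono (n : nat) (t : R) : R := t ^ n / INR (fact n).

Lemma is_derive_mono (n : nat) (t : R) : is_derive (mono (S n)) t (mono n t).
Proof.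
  unfold mono; auto_derive; [trivial|].
  change (1 * (INR (S n) * t ^ n) * / INR (S n * fact n) = t ^ n / INR (fact n)).
  rewrite mult_INR; field.
  split; apply not_0_INR; [apply fact_neq_0|lia].
Qed.

Lemma is_derive_mono_deg0 (t : R) : is_derive (mono 0) t 0.
Proof. unfold mono; auto_derive; [trivial|simpl; ring]. Qed.

Lemma continuous_mono (n : nat) (t : R) : continuous (mono n) t.
Proof. apply (ex_derive_continuous (mono n)); unfold mono; auto_derive; trivial. Qed.

Lemma mono_at_0 (n : nat) : mono (S n) 0 = 0.
Proof. unfold mono; simpl; unfold Rdiv; ring. Qed.

Lemma mono_deg0 (t : R) : mono 0 t = 1.
Proof. unfold mono; simpl; field. Qed.

(** Each double integration by parts lowers the degree by 2 and contributes a boundary term at pi/2.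
    The endpoint 0 contributes only in degree 0, which gives the isolated last term. *)
Lemma sin_moment_mono (N : nat) (x : R) :
  x <> 0 -> sin (x * (PI / 2)) = 0 ->
  sin_moment (mono (2 * N)) x
  = - cos (x * (PI / 2)) * sum_n (fun j => (-1) ^ j * mono (2 * (N - j)) (PI / 2) / x ^ (2 * j + 1)) N
    + (-1) ^ N / x ^ (2 * N + 1).
Proof.
  intros hx hs; induction N as [|N IH].
  - rewrite (sin_moment_parts _ (fun _ => 0) (fun _ => 0)); trivial.
    + rewrite sum_O; unfold sin_moment.
      rewrite (RInt_ext _ (fun _ => 0)) by (intros; apply Rmult_0_l).
      rewrite RInt_const; change (scal (PI / 2 - 0) 0) with ((PI / 2 - 0) * 0).
      simpl (2 * _)%nat; rewrite !mono_deg0; simpl; field; exact hx.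
    + intros t; apply is_derive_mono_deg0.
    + intros t; auto_derive; trivial.
    + intros t; apply continuous_const.
  - rewrite (sin_moment_parts _ (mono (2 * N + 1)) (mono (2 * N))); trivial.
    + rewrite IH, sum_n_R_first.
      replace (2 * S N)%nat with (S (2 * N + 1)) by lia.
      rewrite mono_at_0, Nat.sub_0_r.
      rewrite (sum_n_R_ext
        (fun k => (-1) ^ S k * mono (2 * (S N - S k)) (PI / 2) / x ^ (2 * S k + 1))
        (fun k => - / x ^ 2 * ((-1) ^ k * mono (2 * (N - k)) (PI / 2) / x ^ (2 * k + 1)))).
      * rewrite sum_n_R_scal.
        replace (2 * S N)%nat with (S (2 * N + 1)) by lia.
        replace (2 * 0 + 1)%nat with 1%nat by lia.
        replace (S (2 * N + 1) + 1)%nat with (2 * N + 1 + 2)%nat by lia.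
        rewrite (pow_add x _ 2).
        simpl ((-1) ^ _); field; auto using pow_nonzero.
      * intros k; replace (S N - S k)%nat with (N - k)%nat by lia.
        replace (2 * S k + 1)%nat with (2 * k + 1 + 2)%nat by lia.
        rewrite (pow_add x _ 2); simpl ((-1) ^ _); field.
        auto using pow_nonzero.
    + intros t; replace (2 * S N)%nat with (S (2 * N + 1)) by lia; apply is_derive_mono.
    + intros t; replace (2 * N + 1)%nat with (S (2 * N)) by lia; apply is_derive_mono.
    + intros t; apply continuous_mono.
Qed.

(** The weight vanishes at pi/2 and the monomial at 0, so no boundary terms arise. Differentiating
    the product twice gives W_N = -(W_(N-1) - 2 M_N)/x^2, with M_N the moment of [mono (2 * N)];
    unrolling it produces the factors 2(j+1). *)
Lemma sin_moment_wmono (N : nat) (x : R) :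
  x <> 0 -> sin (x * (PI / 2)) = 0 ->
  sin_moment (fun t => (PI / 2 - t) * mono (2 * N + 1) t) x
  = - cos (x * (PI / 2)) *
      sum_n (fun j => (-1) ^ j * (2 * INR (j + 1)) * mono (2 * (N - j)) (PI / 2) / x ^ (2 * j + 3)) N
    + (-1) ^ N * (2 * INR (N + 1)) / x ^ (2 * N + 3).
Proof.
  intros hx hs.
  (* The derivative [f2] of [mono (2 * N)] stays abstract, to cover both 0 for N = 0 and a monomial
     for larger N. *)
  assert (hstep : forall N (f2 : R -> R), (forall t, is_derive (mono (2 * N)) t (f2 t)) ->
     (forall t, continuous f2 t) ->
     sin_moment (fun t => (PI / 2 - t) * mono (2 * N + 1) t) x
     = - (sin_moment (fun t => (PI / 2 - t) * f2 t) x - 2 * sin_moment (mono (2 * N)) x) / x ^ 2).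
  { clear N; intros N f2 h2 hc.
    replace (2 * N + 1)%nat with (S (2 * N)) by lia.
    rewrite (sin_moment_parts _
       (fun t => (PI / 2 - t) * mono (2 * N) t - mono (S (2 * N)) t)
       (fun t => 1 * ((PI / 2 - t) * f2 t) + (- 2) * mono (2 * N) t)); trivial.
    - rewrite mono_at_0, sin_moment_lin.
      + field; exact hx.
      + intros t; apply continuous_Rmult; auto using continuous_affine.
      + intros t; apply continuous_mono.
    - intros t; apply is_derive_affine_mul, is_derive_mono.
    - intros t; eapply is_derive_eq.
      + apply is_derive_R_minus; [apply is_derive_affine_mul, h2|apply is_derive_mono].
      + simpl; ring.
    - intros t; apply continuous_Rplus; apply continuous_Rmult;
        auto using continuous_const, continuous_mono, continuous_Rmult, continuous_affine. }
  induction N as [|N IH].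
  - rewrite (hstep O (fun _ => 0)), sin_moment_mono; trivial.
    + rewrite !sum_O; unfold sin_moment.
      rewrite (RInt_ext _ (fun _ => 0)) by (intros; simpl; ring).
      rewrite RInt_const; change (scal (PI / 2 - 0) 0) with ((PI / 2 - 0) * 0).
      simpl (2 * _)%nat; rewrite !mono_deg0; simpl; field; exact hx.
    + apply is_derive_mono_deg0.
    + intros; apply continuous_const.
  - rewrite (hstep (S N) (mono (2 * N + 1))), IH, sin_moment_mono; trivial.
    + rewrite !(sum_n_R_first _ N).
      rewrite (sum_n_R_ext (fun k => (-1) ^ S k * mono (2 * (S N - S k)) (PI / 2) / x ^ (2 * S k + 1))
        (fun k => (-1) * ((-1) ^ k * mono (2 * (N - k)) (PI / 2) / x ^ (2 * k + 3)))).
      2:{ intros k; replace (S N - S k)%nat with (N - k)%nat by lia.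
          replace (2 * S k + 1)%nat with (2 * k + 3)%nat by lia.
          simpl ((-1) ^ _); unfold Rdiv; ring. }
      rewrite sum_n_R_scal.
      (* Since 2(k+2) = 2(k+1) + 2, the shifted sum splits into the one from the induction
         hypothesis and the one from [sin_moment_mono]. *)
      rewrite (sum_n_R_ext (fun k => (-1) ^ S k * (2 * INR (S k + 1)) * mono (2 * (S N - S k)) (PI / 2) / x ^ (2 * S k + 3))
        (fun k => - / x ^ 2 *
           ((-1) ^ k * (2 * INR (k + 1)) * mono (2 * (N - k)) (PI / 2) / x ^ (2 * k + 3)
            + 2 * ((-1) ^ k * mono (2 * (N - k)) (PI / 2) / x ^ (2 * k + 3))))).
      2:{ intros k; replace (S N - S k)%nat with (N - k)%nat by lia.
          replace (2 * S k + 3)%nat with (2 * k + 3 + 2)%nat by lia.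
          rewrite (pow_add x _ 2), !plus_INR, (S_INR k); simpl ((-1) ^ _); simpl (INR 1).
          field; auto using pow_nonzero. }
      rewrite sum_n_R_scal.
      rewrite sum_n_R_plus, sum_n_R_scal.
      replace (2 * S N + 1)%nat with (2 * N + 3)%nat by lia.
      replace (2 * S N + 3)%nat with (2 * N + 3 + 2)%nat by lia.
      rewrite (pow_add x _ 2), !plus_INR, (S_INR N); simpl ((-1) ^ _); simpl (INR _).
      simpl (2 * 0 + _)%nat.
      field; auto using pow_nonzero.
    + intros t; replace (2 * S N)%nat with (S (2 * N + 1)) by lia; apply is_derive_mono.
    + intros; apply continuous_mono.
Qed.

(** * Fourier coefficients of (pi/2 - t) f *)

(* Series are indexed from 0, so index k stands for m = k + 1 and frequency 2m. *)
Definition freq (k : nat) : R := 2 * INR (k + 1).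

Lemma freq_pos (k : nat) : 0 < freq k.
Proof. unfold freq; assert (0 < INR (k + 1)) by (apply lt_0_INR; lia); lra. Qed.

Lemma freq_S (k : nat) : freq (S k) = freq k + 2.
Proof. unfold freq; rewrite !plus_INR, (S_INR k); ring. Qed.

(** The angle is m pi with m = k+1, whence the sign (-1)^m = -(-1)^k. *)
Lemma trig_freq (k : nat) :
  sin (freq k * (PI / 2)) = 0 /\ cos (freq k * (PI / 2)) = - (-1) ^ k.
Proof.
  induction k as [|k [IHs IHc]].
  - unfold freq; simpl INR; replace (2 * 1 * (PI / 2)) with PI by field.
    rewrite sin_PI, cos_PI; simpl; split; ring.
  - rewrite freq_S; replace ((freq k + 2) * (PI / 2)) with (freq k * (PI / 2) + PI) by field.
    rewrite neg_sin, neg_cos, IHs, IHc; simpl; split; ring.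
Qed.

(** Formally cot t = 2 Sum_m sin(2mt), so the sum of these coefficients over [k] stands for the
    integral of (pi/2 - t) f(t) cot t. *)
Definition fourier_coef (f : R -> R) (k : nat) : R :=
  2 * sin_moment (fun t => (PI / 2 - t) * f t) (freq k).

Lemma fourier_coef_lin (c d : R) (f g : R -> R) (k : nat) :
  (forall t, continuous f t) -> (forall t, continuous g t) ->
  fourier_coef (fun t => c * f t + d * g t) k = c * fourier_coef f k + d * fourier_coef g k.
Proof.
  intros hf hg; unfold fourier_coef.
  rewrite (sin_moment_ext _
    (fun t => c * ((PI / 2 - t) * f t) + d * ((PI / 2 - t) * g t))) by (intros; ring).
  rewrite sin_moment_lin; [ring| |]; intros; apply continuous_Rmult;
    auto using continuous_affine.
Qed.

Lemma continuous_sum_n (c : nat -> R) (f : nat -> R -> R) (n : nat) (t : R) :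
  (forall k, continuous (f k) t) -> continuous (fun u => sum_n (fun k => c k * f k u) n) t.
Proof.
  intros h; induction n as [|n IH].
  - apply continuous_ext with (fun u => c O * f O u); [intros; rewrite sum_O; reflexivity|].
    apply continuous_Rmult; auto using continuous_const.
  - apply continuous_ext with (fun u => sum_n (fun k => c k * f k u) n + c (S n) * f (S n) u);
      [intros; rewrite sum_n_R_S; reflexivity|].
    apply continuous_Rplus; auto using continuous_Rmult, continuous_const.
Qed.

Lemma fourier_coef_sum_n (c : nat -> R) (f : nat -> R -> R) (n k : nat) :
  (forall i t, continuous (f i) t) ->
  fourier_coef (fun t => sum_n (fun i => c i * f i t) n) k
  = sum_n (fun i => c i * fourier_coef (f i) k) n.
Proof.
  intros h; induction n as [|n IH].
  - rewrite sum_O; unfold fourier_coef.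
    (* The zero summand lets two-term linearity extract a single constant. *)
    rewrite (sin_moment_ext _ (fun t => c O * ((PI / 2 - t) * f O t) + 0 * ((PI / 2 - t) * f O t)))
      by (intros; rewrite sum_O; ring).
    rewrite sin_moment_lin; [simpl; ring| |]; intros; apply continuous_Rmult;
      auto using continuous_affine.
  - rewrite sum_n_R_S, <- IH.
    replace (fourier_coef (fun t => sum_n (fun i => c i * f i t) n) k)
      with (1 * fourier_coef (fun t => sum_n (fun i => c i * f i t) n) k) by apply Rmult_1_l.
    rewrite <- fourier_coef_lin; auto using continuous_sum_n.
    unfold fourier_coef; f_equal; apply sin_moment_ext; intros t.
    rewrite sum_n_R_S; ring.
Qed.

Lemma is_series_R_ext (a b : nat -> R) (l : R) :
  (forall k, a k = b k) -> is_series a l -> is_series b l.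
Proof. exact (is_series_ext a b l). Qed.

Lemma is_series_R_plus (a b : nat -> R) (la lb : R) :
  is_series a la -> is_series b lb -> is_series (fun k => a k + b k) (la + lb).
Proof. exact (is_series_plus a b la lb). Qed.

Lemma is_series_R_scal (c : R) (a : nat -> R) (l : R) :
  is_series a l -> is_series (fun k => c * a k) (c * l).
Proof. exact (is_series_scal_l c a l). Qed.

Lemma is_series_sum_n (c : nat -> R) (a : nat -> nat -> R) (l : nat -> R) (n : nat) :
  (forall i, is_series (a i) (l i)) ->
  is_series (fun k => sum_n (fun i => c i * a i k) n) (sum_n (fun i => c i * l i) n).
Proof.
  intros h; induction n as [|n IH].
  - rewrite sum_O; apply is_series_ext with (fun k => c O * a O k);
      [intros; rewrite sum_O; reflexivity|apply is_series_R_scal, h].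
  - rewrite sum_n_R_S.
    apply is_series_ext with (fun k => sum_n (fun i => c i * a i k) n + c (S n) * a (S n) k);
      [intros; rewrite sum_n_R_S; reflexivity|].
    apply is_series_R_plus; [exact IH|apply is_series_R_scal, h].
Qed.

(* The terms j < N match the eta sum of the theorem; the term j = N is merged there with the zeta term. *)
Definition t_3_twos_value (N : nat) : R :=
  sum_n (fun j => 4 * INR (j + 1) * (-1) ^ j * mono (2 * (N - j)) (PI / 2) / 2 ^ (2 * j + 3)
                  * eta (2 * j + 3)) N
  + 4 * INR (N + 1) * (-1) ^ N / 2 ^ (2 * N + 3) * zeta (2 * N + 3).

(** Boundary terms at pi/2 carry the sign (-1)^k and sum to eta values; the term from the endpoint 0
    has no such sign and sums to a zeta value. *)
Lemma is_series_fourier_mono (N : nat) :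
  is_series (fourier_coef (mono (2 * N + 1))) (t_3_twos_value N).
Proof.
  apply is_series_R_ext with (fun k =>
    sum_n (fun j => 4 * INR (j + 1) * (-1) ^ j * mono (2 * (N - j)) (PI / 2) / 2 ^ (2 * j + 3)
                    * ((-1) ^ k * / INR (k + 1) ^ (2 * j + 3))) N
    + 4 * INR (N + 1) * (-1) ^ N / 2 ^ (2 * N + 3) * / INR (k + 1) ^ (2 * N + 3)).
  - intros k; unfold fourier_coef.
    destruct (trig_freq k) as [hs hc]; pose proof (freq_pos k) as hf.
    assert (hk : INR (k + 1) <> 0) by (apply not_0_INR; lia).
    rewrite sin_moment_wmono by (trivial; lra); rewrite hc.
    rewrite (sum_n_R_ext _ (fun j => 2 * (-1) ^ k *
       ((-1) ^ j * (2 * INR (j + 1)) * mono (2 * (N - j)) (PI / 2) / freq k ^ (2 * j + 3)))).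
    + rewrite sum_n_R_scal; unfold freq; rewrite Rpow_mult_distr; field.
      split; apply pow_nonzero; [exact hk|lra].
    + intros j; unfold freq; rewrite Rpow_mult_distr; field.
      split; apply pow_nonzero; [exact hk|lra].
  - apply is_series_R_plus.
    + apply (is_series_sum_n _ (fun j k => (-1) ^ k * / INR (k + 1) ^ (2 * j + 3))
               (fun j => eta (2 * j + 3))).
      intros j; apply is_series_eta; lia.
    + apply is_series_R_scal, is_series_zeta; lia.
Qed.

(** * Powers of the sine *)

Definition sin_term (n : nat) (t : R) : R := arcsin_coef n * sin t ^ (2 * n + 1).
Definition sin_term1 (n : nat) (t : R) : R :=
  arcsin_coef n * INR (2 * n + 1) * (sin t ^ (2 * n) * cos t).
(** With a = 2n+1 the recurrence turns a(a-1) c_n into (2n-1)^2 c_(n-1), so the second derivative is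
    a difference of consecutive terms. For n = 0 the factor a(a-1) is 0. *)
Definition sin_term2 (n : nat) (t : R) : R :=
  match n with
  | O => 0
  | S m => INR (2 * m + 1) ^ 2 * sin_term m t
  end - INR (2 * n + 1) ^ 2 * sin_term n t.

Lemma is_derive_sin_pow (c t : R) (m : nat) :
  is_derive (fun u => c * sin u ^ (m + 1)) t (c * INR (m + 1) * (sin t ^ m * cos t)).
Proof.
  rewrite Nat.add_1_r; auto_derive; [trivial|].
  change (c * (1 * cos t * (INR (S m) * sin t ^ m)) = c * INR (S m) * (sin t ^ m * cos t)); ring.
Qed.

Lemma is_derive_sin_pow_cos (c t : R) (m : nat) :
  is_derive (fun u => c * (sin u ^ (m + 1) * cos u)) t
    (c * (INR (m + 1) * sin t ^ m - (INR (m + 1) + 1) * sin t ^ (m + 2))).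
Proof.
  rewrite Nat.add_1_r; auto_derive; [trivial|].
  change (c * (1 * cos t * (INR (S m) * sin t ^ m) * cos t + sin t * sin t ^ m * (1 * - sin t))
    = c * (INR (S m) * sin t ^ m - (INR (S m) + 1) * sin t ^ (m + 2))).
  transitivity (c * (INR (S m) * sin t ^ m * (cos t * cos t) - sin t ^ m * (sin t * sin t)));
    [ring|].
  replace (cos t * cos t) with (1 - sin t * sin t) by (pose proof (sin2_cos2 t); unfold Rsqr in *; lra).
  rewrite pow_add; ring.
Qed.

Lemma is_derive_sin_term (n : nat) (t : R) : is_derive (sin_term n) t (sin_term1 n t).
Proof. apply is_derive_sin_pow. Qed.

Lemma is_derive_sin_term1 (n : nat) (t : R) : is_derive (sin_term1 n) t (sin_term2 n t).
Proof.
  destruct n as [|m].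
  - unfold sin_term1, sin_term2, sin_term; auto_derive; [trivial|simpl; ring].
  - unfold sin_term1; replace (2 * S m)%nat with (2 * m + 1 + 1)%nat by lia.
    eapply is_derive_eq; [apply is_derive_sin_pow_cos|].
    unfold sin_term2, sin_term; rewrite INR_odd_S.
    replace (2 * S m + 1)%nat with (2 * m + 1 + 2)%nat by lia.
    cbn [arcsin_coef]; pose proof (INR_odd_pos m) as hp.
    set (p := (2 * m + 1)%nat) in *.
    rewrite (plus_INR (p + 1)), (plus_INR p); simpl (INR 1); field; lra.
Qed.

Lemma continuous_sin_term (n : nat) (t : R) : continuous (sin_term n) t.
Proof. apply (derive_continuous _ (sin_term1 n)), is_derive_sin_term. Qed.

Lemma continuous_sin_term1 (n : nat) (t : R) : continuous (sin_term1 n) t.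
Proof. apply (derive_continuous _ (sin_term2 n)), is_derive_sin_term1. Qed.

Lemma continuous_sin_pow (n : nat) (t : R) : continuous (fun u => sin u ^ n) t.
Proof. apply (ex_derive_continuous (fun u => sin u ^ n)); auto_derive; trivial. Qed.

Lemma sin_term_0 (n : nat) : sin_term n 0 = 0.
Proof. unfold sin_term; rewrite sin_0, Nat.add_1_r; simpl; ring. Qed.

(** Wallis recursion: for n >= 1 the first derivative vanishes at both ends, so the second
    integrates to 0 and (2n+1)^2 times the integral does not depend on [n]. *)
Lemma RInt_sin_term (n : nat) : RInt (sin_term n) 0 (PI / 2) = / INR (2 * n + 1) ^ 2.
Proof.
  induction n as [|n IH].
  - rewrite (RInt_primitive (fun t => - cos t)).
    + rewrite cos_0, cos_PI2; simpl; field.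
    + intros t; unfold sin_term; auto_derive; [trivial|simpl; ring].
    + apply continuous_sin_term.
  - assert (e : RInt (sin_term2 (S n)) 0 (PI / 2) = 0 :> R).
    { rewrite (RInt_primitive (sin_term1 (S n))).
      - unfold sin_term1; rewrite cos_PI2, sin_0.
        replace (2 * S n)%nat with (S (2 * n + 1)) by lia; simpl (0 ^ _); ring.
      - apply is_derive_sin_term1.
      - intros t; unfold sin_term2; apply continuous_Rminus; apply continuous_Rmult;
          auto using continuous_const, continuous_sin_term. }
    rewrite (RInt_ext _ (fun t => INR (2 * n + 1) ^ 2 * sin_term n t
               + - INR (2 * S n + 1) ^ 2 * sin_term (S n) t)) in e
      by (intros; unfold sin_term2; simpl; ring).
    rewrite RInt_lin, IH in e by apply continuous_sin_term.
    pose proof (INR_odd_pos n); pose proof (INR_odd_pos (S n)).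
    rewrite Rinv_r in e by (apply pow_nonzero; lra).
    apply Rmult_eq_reg_l with (INR (2 * S n + 1) ^ 2); [|apply pow_nonzero; lra].
    rewrite Rinv_r by (apply pow_nonzero; lra); lra.
Qed.

(** The integrand is (pi/2 - t) cot t times [sin_term n t], that is (pi/2 - t) [sin_term1 n t] /
    (2n+1). Integration by parts has no boundary terms and leaves [RInt_sin_term]. *)
Lemma RInt_wcot_sin_term (n : nat) :
  RInt (fun t => (PI / 2 - t) * (arcsin_coef n * (sin t ^ (2 * n) * cos t))) 0 (PI / 2)
  = / INR (2 * n + 1) ^ 3.
Proof.
  pose proof (INR_odd_pos n) as hx; set (x := INR (2 * n + 1)) in *.
  assert (e : RInt (fun t => / x * ((PI / 2 - t) * sin_term1 n t) + - / x * sin_term n t) 0 (PI / 2) = 0 :> R).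
  { rewrite (RInt_primitive (fun t => / x * ((PI / 2 - t) * sin_term n t))).
    - rewrite sin_term_0; ring.
    - intros t; eapply is_derive_eq.
      + apply (is_derive_scal (fun u => (PI / 2 - u) * sin_term n u)).
        apply is_derive_affine_mul, is_derive_sin_term.
      + simpl; ring.
    - intros t; apply continuous_Rplus; apply continuous_Rmult;
        auto using continuous_const, continuous_Rmult, continuous_affine,
          continuous_sin_term, continuous_sin_term1. }
  rewrite RInt_lin in e;
    [|intros t; apply continuous_Rmult; auto using continuous_affine, continuous_sin_term1
     |apply continuous_sin_term].
  rewrite RInt_sin_term in e; fold x in e.
  rewrite (RInt_ext _ (fun t => / x * ((PI / 2 - t) * sin_term1 n t)
              + 0 * ((PI / 2 - t) * sin_term1 n t))).
  2:{ intros t _; unfold sin_term1; fold x; simpl; field; lra. }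
  rewrite RInt_lin; [|intros t; apply continuous_Rmult; auto using continuous_affine, continuous_sin_term1 ..].
  rewrite Rmult_0_l, Rplus_0_r.
  apply Rplus_eq_reg_r with (- / x * / x ^ 2); rewrite e; field; lra.
Qed.

(** A Riemann-Lebesgue estimate with rate 1/x by one integration by parts; the boundary terms vanish
    since g(pi/2) = 0 and sin 0 = 0. *)
Lemma cos_moment_bound (g g1 : R -> R) (x : R) :
  (forall t, is_derive g t (g1 t)) -> (forall t, continuous g1 t) -> 0 < x -> g (PI / 2) = 0 ->
  Rabs (RInt (fun t => g t * cos (x * t)) 0 (PI / 2)) <= RInt (fun t => Rabs (g1 t)) 0 (PI / 2) / x.
Proof.
  intros hd hc hx hg.
  assert (cg : forall t, continuous g t) by (intros t; apply (derive_continuous g g1), hd).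
  assert (e : RInt (fun t => x * (g t * cos (x * t)) + 1 * (g1 t * sin (x * t))) 0 (PI / 2) = 0 :> R).
  { rewrite (RInt_primitive (fun t => g t * sin (x * t))).
    - rewrite hg, Rmult_0_r, sin_0; ring.
    - intros t; auto_derive; [exists (g1 t); apply hd|].
      rewrite (Derive_eta _ _ _ (hd t)); ring.
    - intros t; apply continuous_Rplus; apply continuous_Rmult;
        auto using continuous_const, continuous_Rmult, continuous_cos_lin, continuous_sin_lin. }
  assert (c1 : forall t, continuous (fun t => g1 t * sin (x * t)) t)
    by (intros; apply continuous_Rmult; auto using continuous_sin_lin).
  rewrite RInt_lin in e; [|intros; apply continuous_Rmult; auto using continuous_cos_lin|exact c1].
  assert (hpi := PI_RGT_0).
  assert (b : Rabs (RInt (fun t => g1 t * sin (x * t)) 0 (PI / 2))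
              <= RInt (fun t => Rabs (g1 t)) 0 (PI / 2)).
  { apply Rle_trans with (1 := abs_RInt_le _ 0 (PI / 2) ltac:(lra) (ex_RInt_cont _ _ _ c1)).
    apply RInt_le; [lra| | |].
    - apply ex_RInt_cont; intros t; apply (continuous_comp _ Rabs); [apply c1|].
      apply continuous_Rabs.
    - apply ex_RInt_cont; intros t; apply (continuous_comp _ Rabs); [apply hc|].
      apply continuous_Rabs.
    - intros t _; rewrite Rabs_mult.
      pose proof (Rabs_pos (g1 t)); assert (Rabs (sin (x * t)) <= 1); [|nra].
      apply Rabs_le, SIN_bound. }
  apply (Rle_div_r _ _ x hx).
  apply Rle_trans with (Rabs (RInt (fun t => g t * cos (x * t)) 0 (PI / 2) * x));
    [rewrite Rabs_mult, (Rabs_pos_eq x) by lra; apply Rle_refl|].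
  replace (RInt _ 0 (PI / 2) * x) with (- RInt (fun t => g1 t * sin (x * t)) 0 (PI / 2)).
  - rewrite Rabs_Ropp; exact b.
  - rewrite Rmult_1_l in e; lra.
Qed.

(* The product 2 sin(2mt) sin t = cos((2m-1)t) - cos((2m+1)t) telescopes over m. *)
Lemma sum_fourier_sin_term (n M : nat) :
  sum_n (fourier_coef (sin_term n)) M
  = / INR (2 * n + 1) ^ 3
    - RInt (fun t => (PI / 2 - t) * (arcsin_coef n * sin t ^ (2 * n)) * cos ((freq M + 1) * t)) 0 (PI / 2).
Proof.
  set (g := fun t => (PI / 2 - t) * (arcsin_coef n * sin t ^ (2 * n))).
  assert (cg : forall t, continuous g t).
  { intros t; apply continuous_Rmult; auto using continuous_affine.
    apply continuous_Rmult; auto using continuous_const, continuous_sin_pow. }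
  assert (cc : forall a t, continuous (fun u => g u * cos (a * u)) t)
    by (intros; apply continuous_Rmult; auto using continuous_cos_lin).
  assert (hk : forall k, fourier_coef (sin_term n) k
     = RInt (fun t => g t * cos ((freq k - 1) * t)) 0 (PI / 2)
       - RInt (fun t => g t * cos ((freq k + 1) * t)) 0 (PI / 2)).
  { intros k; unfold fourier_coef, sin_moment.
    replace (RInt (fun t => g t * cos ((freq k - 1) * t)) 0 (PI / 2)
       - RInt (fun t => g t * cos ((freq k + 1) * t)) 0 (PI / 2))
      with (1 * RInt (fun t => g t * cos ((freq k - 1) * t)) 0 (PI / 2)
       + -1 * RInt (fun t => g t * cos ((freq k + 1) * t)) 0 (PI / 2)) by ring.
    rewrite <- RInt_lin by apply cc.
    set (f := fun t => (PI / 2 - t) * sin_term n t * sin (freq k * t)).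
    replace (2 * RInt f 0 (PI / 2)) with (2 * RInt f 0 (PI / 2) + 0 * RInt f 0 (PI / 2)) by ring.
    assert (cf : forall t, continuous f t).
    { intros t; apply continuous_Rmult; [|apply continuous_sin_lin].
      apply continuous_Rmult; auto using continuous_affine, continuous_sin_term. }
    rewrite <- RInt_lin by exact cf.
    apply RInt_ext; intros t _; unfold f, g, sin_term.
    replace ((freq k - 1) * t) with (freq k * t - t) by ring.
    replace ((freq k + 1) * t) with (freq k * t + t) by ring.
    rewrite cos_minus, cos_plus, pow_add; simpl; ring. }
  change (fun t => (PI / 2 - t) * (arcsin_coef n * sin t ^ (2 * n)) * cos ((freq M + 1) * t))
    with (fun t => g t * cos ((freq M + 1) * t)).
  induction M as [|M IH].
  (* The lowest frequency is 2 - 1 = 1, and its factor cos t yields exactly the cotangent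
     integral. *)
  - rewrite sum_O, hk, <- RInt_wcot_sin_term; f_equal.
    apply RInt_ext; intros t _; unfold g, freq; simpl (INR _).
    replace ((2 * 1 - 1) * t) with t by ring; simpl; ring.
  - rewrite sum_n_R_S, IH, hk, freq_S.
    replace (freq M + 2 - 1) with (freq M + 1) by ring.
    simpl; ring.
Qed.

(** The error of the partial sum is a cosine integral of frequency 2M+3 whose weight vanishes at
    pi/2, hence O(1/M). *)
Lemma is_series_fourier_sin_term (n : nat) :
  is_series (fourier_coef (sin_term n)) (/ INR (2 * n + 1) ^ 3).
Proof.
  change (is_lim_seq (sum_n (fourier_coef (sin_term n))) (/ INR (2 * n + 1) ^ 3)).
  eapply is_lim_seq_ext; [intros M; symmetry; apply sum_fourier_sin_term|].
  replace (Finite (/ INR (2 * n + 1) ^ 3)) with (Finite (/ INR (2 * n + 1) ^ 3 - 0))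
    by (f_equal; ring).
  apply is_lim_seq_minus'; [apply is_lim_seq_const|].
  apply is_lim_seq_abs_0.
  set (g := fun t => (PI / 2 - t) * (arcsin_coef n * sin t ^ (2 * n))).
  (* The derivative of [g]; at n = 0 the factor [INR (2 * n)] cancels the term with the truncated
     exponent [pred 0]. *)
  set (g1 := fun t => (PI / 2 - t) *
     (arcsin_coef n * (INR (2 * n) * sin t ^ pred (2 * n) * cos t)) - arcsin_coef n * sin t ^ (2 * n)).
  apply is_lim_seq_le_le_loc with (fun _ => 0)
    (fun M => RInt (fun t => Rabs (g1 t)) 0 (PI / 2) * / INR M).
  - exists 1%nat; intros M hM; split; [apply Rabs_pos|].
    assert (hM0 : 0 < INR M) by (apply lt_0_INR; lia).
    assert (hfM : INR M <= freq M + 1).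
    { unfold freq; rewrite plus_INR; simpl (INR 1); lra. }
    apply Rle_trans with (RInt (fun t => Rabs (g1 t)) 0 (PI / 2) / (freq M + 1)).
    + apply (cos_moment_bound g g1); [| |lra|].
      * intros t; apply (is_derive_affine_mul (PI / 2) t _ (fun u => arcsin_coef n * sin u ^ (2 * n))).
        generalize (2 * n)%nat as m; intros m; auto_derive; [trivial|ring].
      * intros t; apply continuous_Rminus; repeat apply continuous_Rmult;
          auto using continuous_affine, continuous_const, continuous_sin_pow, continuous_cos.
      * unfold g; ring.
    + apply Rmult_le_compat_l.
      * apply RInt_ge_0; [assert (h := PI_RGT_0); lra| |intros; apply Rabs_pos].
        apply ex_RInt_cont; intros t; apply (continuous_comp g1 Rabs); [|apply continuous_Rabs].
        apply continuous_Rminus; repeat apply continuous_Rmult;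
          auto using continuous_affine, continuous_const, continuous_sin_pow, continuous_cos.
      * apply Rinv_le_contravar; lra.
  - apply is_lim_seq_const.
  - replace (Finite 0) with (Rbar_mult (RInt (fun t => Rabs (g1 t)) 0 (PI / 2)) 0)
      by (simpl; f_equal; ring).
    apply is_lim_seq_scal_l, (is_lim_seq_inv INR p_infty); [apply is_lim_seq_INR|discriminate].
Qed.

(** * The remainder of the expansion in powers of the sine *)

(** With u = pi/2 - t <= 2, sin u >= u - u^3/6 >= u/3. Trading the weight for a cosine makes (pi/2 -
    t) sin^p t comparable to an exact derivative. *)
Lemma dist_PI2_le_cos (t : R) : 0 <= t <= PI / 2 -> PI / 2 - t <= 3 * cos t.
Proof.
  intros ht; pose proof PI_4 as h4.
  rewrite <- sin_shift; set (u := PI / 2 - t).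
  assert (hu : 0 <= u <= 2) by (unfold u; lra).
  destruct (sin_bound u 0) as [h _]; [lra|unfold u; lra|].
  unfold sin_approx, Rtrigo_alt.sin_term in h; simpl in h.
  assert (u * u * u <= 4 * u) by nra; lra.
Qed.

(* r(pi/2) is the increment of (pi/2 - t) r'(t) + r(t), whose derivative is (pi/2 - t) r''(t). *)
Lemma convex_remainder (r r1 r2 : R -> R) (E D : R) (p : nat) :
  (forall t, is_derive r t (r1 t)) -> (forall t, is_derive r1 t (r2 t)) ->
  r 0 = 0 -> r1 0 = 0 -> 0 <= E -> 0 <= D ->
  (forall t, 0 <= t <= PI / 2 -> 0 <= r2 t <= E + D * sin t ^ p) ->
  (forall t, 0 <= t <= PI / 2 -> 0 <= r1 t) /\
  (forall t, 0 <= t <= PI / 2 -> 0 <= r t <= r (PI / 2)) /\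
  r (PI / 2) <= (PI / 2) ^ 2 * E + 3 * (D / INR (p + 1)).
Proof.
  intros h1 h2 e0 e1 hE hD hb; pose proof PI_RGT_0 as hpi.
  assert (hc : forall t, is_derive (fun _ : R => 0) t 0)
    by (intros t; auto_derive; trivial).
  assert (hr1 : forall t, 0 <= t <= PI / 2 -> 0 <= r1 t).
  { intros t ht.
    pose proof (increment_le _ r1 _ r2 0 t ltac:(lra) hc h2) as h.
    cut (0 - 0 <= r1 t - r1 0); [lra|apply h; intros u hu; apply hb; lra]. }
  assert (hr : forall s t, 0 <= s <= t -> t <= PI / 2 -> r s <= r t).
  { intros s t hs ht.
    pose proof (increment_le _ r _ r1 s t ltac:(lra) hc h1) as h.
    cut (0 - 0 <= r t - r s); [lra|apply h; intros u hu; apply hr1; lra]. }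
  split; [exact hr1|split].
  - intros t ht; split; [rewrite <- e0|]; apply hr; lra.
  - assert (hp : 0 < INR (p + 1)) by (apply lt_0_INR; lia).
    (* The comparison function has derivative (pi/2) E + 3 D sin^p cos, which dominates (pi/2 - t)
       r'' since pi/2 - t is at most pi/2 and at most 3 cos t. *)
    pose proof (increment_le (fun t => (PI / 2 - t) * r1 t + r t)
      (fun t => (PI / 2) * E * t + 3 * D / INR (p + 1) * sin t ^ (p + 1))
      (fun t => (PI / 2 - t) * r2 t)
      (fun t => (PI / 2) * E + 3 * D * (sin t ^ p * cos t)) 0 (PI / 2)) as h.
    cut ((PI / 2 - PI / 2) * r1 (PI / 2) + r (PI / 2) - ((PI / 2 - 0) * r1 0 + r 0)
      <= (PI / 2) * E * (PI / 2) + 3 * D / INR (p + 1) * sin (PI / 2) ^ (p + 1)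
         - ((PI / 2) * E * 0 + 3 * D / INR (p + 1) * sin 0 ^ (p + 1))).
    { rewrite e0, e1, sin_PI2, sin_0, pow1, pow_i by lia; intros h'.
      replace ((PI / 2) ^ 2 * E + 3 * (D / INR (p + 1)))
        with ((PI / 2) * E * (PI / 2) + 3 * D / INR (p + 1) * 1) by (field; lra); lra. }
    apply h; clear h; [lra| | |].
    + intros t; eapply is_derive_eq.
      * apply (is_derive_plus (fun u => (PI / 2 - u) * r1 u) r);
          [apply is_derive_affine_mul, h2|apply h1].
      * change ((PI / 2 - t) * r2 t - r1 t + r1 t = (PI / 2 - t) * r2 t); ring.
    + intros t; eapply is_derive_eq.
      * apply (is_derive_plus (fun u => (PI / 2) * E * u)
          (fun u => 3 * D / INR (p + 1) * sin u ^ (p + 1))); [|apply is_derive_sin_pow].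
        apply is_derive_scal, is_derive_id.
      * change ((PI / 2) * E * 1 + 3 * D / INR (p + 1) * INR (p + 1) * (sin t ^ p * cos t)
          = (PI / 2) * E + 3 * D * (sin t ^ p * cos t)); field; lra.
    + intros t ht; destruct (hb t ht) as [b0 b1].
      pose proof (dist_PI2_le_cos t ht) as hj.
      assert (hs : 0 <= sin t ^ p) by (apply pow_le, sin_ge_0; lra).
      apply Rle_trans with ((PI / 2 - t) * (E + D * sin t ^ p)).
      * apply Rmult_le_compat_l; lra.
      * assert (0 <= D * sin t ^ p) by (apply Rmult_le_pos; lra). nra.
Qed.

Definition remainder (N K : nat) (t : R) : R :=
  mono (2 * N + 1) t - sum_n (fun n => t_twos N n * sin_term n t) K.
Definition remainder1 (N K : nat) (t : R) : R :=
  mono (2 * N) t - sum_n (fun n => t_twos N n * sin_term1 n t) K.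
(** Differentiating twice returns the remainder of stage N-1 plus one telescoping boundary term; at
    stage 0 the monomial is t, with second derivative 0. *)
Definition remainder2 (N K : nat) (t : R) : R :=
  match N with O => 0 | S N' => remainder N' K t end
  + t_twos N (S K) * (INR (2 * K + 1) ^ 2 * sin_term K t).

Lemma is_derive_sum (c : nat -> R) (f f1 : nat -> R -> R) (n : nat) (t : R) :
  (forall k, is_derive (f k) t (f1 k t)) ->
  is_derive (fun u => sum_n (fun k => c k * f k u) n) t (sum_n (fun k => c k * f1 k t) n).
Proof.
  intros h; apply (is_derive_sum_n (fun k u => c k * f k u)).
  intros k _; apply is_derive_scal, h.
Qed.

Lemma is_derive_remainder (N K : nat) (t : R) :
  is_derive (remainder N K) t (remainder1 N K t).
Proof.
  apply is_derive_R_minus.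
  - rewrite Nat.add_1_r; apply is_derive_mono.
  - apply is_derive_sum; intros k; apply is_derive_sin_term.
Qed.

(** Summation by parts: T_N(n+1) - T_N(n) = T_(N-1)(n)/(2n+1)^2 cancels the factor (2n+1)^2. For N =
    0 the weights are constant and only the last term survives. *)
Lemma sum_t_twos_sin_term2 (N K : nat) (t : R) :
  sum_n (fun n => t_twos N n * sin_term2 n t) K
  = match N with O => 0 | S N' => sum_n (fun n => t_twos N' n * sin_term n t) K end
    - t_twos N (S K) * (INR (2 * K + 1) ^ 2 * sin_term K t) :> R.
Proof.
  induction K as [|K IH].
  - destruct N as [|N]; rewrite !sum_O.
    + rewrite !t_twos_nil; unfold sin_term2; simpl; ring.
    + rewrite t_twos_S_S, t_twos_S_0; unfold sin_term2; simpl; field.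
  - rewrite sum_n_R_S, IH; unfold sin_term2.
    destruct N as [|N].
    + rewrite !t_twos_nil; ring.
    + rewrite (t_twos_S_S N (S K)), sum_n_R_S.
      pose proof (INR_odd_pos (S K)); field; lra.
Qed.

Lemma is_derive_remainder1 (N K : nat) (t : R) :
  is_derive (remainder1 N K) t (remainder2 N K t).
Proof.
  eapply is_derive_eq.
  - apply (is_derive_R_minus (mono (2 * N)) _ t
      (match N with O => 0 | S N' => mono (2 * N' + 1) t end)).
    + destruct N as [|N]; [apply is_derive_mono_deg0|].
      replace (2 * S N)%nat with (S (2 * N + 1)) by lia; apply is_derive_mono.
    + apply is_derive_sum; intros k; apply is_derive_sin_term1.
  - rewrite sum_t_twos_sin_term2; unfold remainder2, remainder; destruct N; ring.
Qed.

Lemma continuous_remainder (N K : nat) (t : R) : continuous (remainder N K) t.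
Proof. apply (derive_continuous _ (remainder1 N K)), is_derive_remainder. Qed.

Lemma continuous_remainder1 (N K : nat) (t : R) : continuous (remainder1 N K) t.
Proof. apply (derive_continuous _ (remainder2 N K)), is_derive_remainder1. Qed.

Lemma continuous_remainder2 (N K : nat) (t : R) : continuous (remainder2 N K) t.
Proof.
  apply continuous_Rplus.
  - destruct N; [apply continuous_const|apply continuous_remainder].
  - apply continuous_Rmult; [apply continuous_const|].
    apply continuous_Rmult; [apply continuous_const|apply continuous_sin_term].
Qed.

Lemma sum_n_zero (a : nat -> R) (n : nat) : (forall k, a k = 0) -> sum_n a n = 0.
Proof.
  intros h; induction n as [|n IH]; [rewrite sum_O; apply h|].
  rewrite sum_n_R_S, IH, h; apply Rplus_0_r.
Qed.

Lemma remainder_0 (N K : nat) : remainder N K 0 = 0.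
Proof.
  unfold remainder; rewrite Nat.add_1_r, mono_at_0, sum_n_zero; [ring|].
  intros k; rewrite sin_term_0; ring.
Qed.

(** At 0 only the term n = 0 survives, with weight T_N(0), which is 1 for N = 0 and 0 otherwise, as
    is the monomial. *)
Lemma remainder1_0 (N K : nat) : remainder1 N K 0 = 0.
Proof.
  assert (h : forall n, sin_term1 n 0 = match n with O => 1 | S _ => 0 end).
  { intros [|n]; unfold sin_term1; rewrite sin_0, cos_0; [simpl; ring|].
    rewrite pow_i by lia; ring. }
  assert (e : sum_n (fun n => t_twos N n * sin_term1 n 0) K = t_twos N 0 :> R).
  { induction K as [|K IH]; [rewrite sum_O|rewrite sum_n_R_S, IH]; rewrite h;
      [apply Rmult_1_r|ring]. }
  unfold remainder1; rewrite e; destruct N as [|N].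
  - rewrite t_twos_nil, mono_deg0; ring.
  - rewrite t_twos_S_0; replace (2 * S N)%nat with (S (2 * N + 1)) by lia; rewrite mono_at_0; ring.
Qed.

Definition remainder_end_pred (N K : nat) : R :=
  match N with O => 0 | S N' => remainder N' K (PI / 2) end.

(** Positivity at the previous stage makes the remainder convex. [convex_remainder] applies with E
    the previous end value, D = 2^N (2K+1)^2 c_K and p = 2K+1; dividing D by p+1 leaves at most 2^N
    (2K+1) c_K. *)
Lemma remainder_control_step (N K : nat) :
  (forall t, 0 <= t <= PI / 2 ->
     0 <= match N with O => 0 | S N' => remainder N' K t end <= remainder_end_pred N K) ->
  (forall t, 0 <= t <= PI / 2 -> 0 <= remainder2 N K t) /\
  (forall t, 0 <= t <= PI / 2 -> 0 <= remainder1 N K t) /\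
  (forall t, 0 <= t <= PI / 2 -> 0 <= remainder N K t <= remainder N K (PI / 2)) /\
  remainder N K (PI / 2)
  <= (PI / 2) ^ 2 * remainder_end_pred N K + 3 * 2 ^ N * (INR (2 * K + 1) * arcsin_coef K).
Proof.
  intros hprev; pose proof PI_RGT_0 as hpi.
  pose proof (INR_odd_pos K) as hx; pose proof (arcsin_coef_pos K) as hw.
  set (x := INR (2 * K + 1)) in *.
  assert (hE : 0 <= remainder_end_pred N K) by (specialize (hprev 0 ltac:(lra)); lra).
  assert (hD : 0 <= 2 ^ N * (x ^ 2 * arcsin_coef K)).
  { apply Rmult_le_pos; [apply pow_le; lra|]. apply Rmult_le_pos; [apply pow2_ge_0|lra]. }
  assert (hb : forall t, 0 <= t <= PI / 2 -> 0 <= remainder2 N K t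
      <= remainder_end_pred N K + 2 ^ N * (x ^ 2 * arcsin_coef K) * sin t ^ (2 * K + 1)).
  { intros t ht; specialize (hprev t ht); unfold remainder2, sin_term; fold x.
    assert (hs : 0 <= x ^ 2 * (arcsin_coef K * sin t ^ (2 * K + 1))).
    { repeat apply Rmult_le_pos; try lra; apply pow_le, sin_ge_0; lra. }
    pose proof (t_twos_nonneg N (S K)); pose proof (t_twos_le N (S K)); nra. }
  destruct (convex_remainder _ _ _ (remainder_end_pred N K) _ (2 * K + 1)
    (is_derive_remainder N K) (is_derive_remainder1 N K)
    (remainder_0 N K) (remainder1_0 N K) hE hD hb) as [a1 [a2 a3]].
  split; [intros t ht; apply hb, ht|split; [exact a1|split; [exact a2|]]].
  apply Rle_trans with (1 := a3), Rplus_le_compat_l.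
  rewrite (plus_INR (2 * K + 1)); simpl (INR 1); fold x.
  replace (3 * (2 ^ N * (x ^ 2 * arcsin_coef K) / (x + 1)))
    with (3 * 2 ^ N * (x * arcsin_coef K) * (x / (x + 1))) by (field; lra).
  rewrite <- (Rmult_1_r (3 * 2 ^ N * (x * arcsin_coef K))) at 2.
  apply Rmult_le_compat_l.
  - pose proof (pow_le 2 N ltac:(lra)); repeat apply Rmult_le_pos; lra.
  - apply (Rle_div_l x 1 (x + 1)); lra.
Qed.

Lemma remainder_control (N K : nat) :
  (forall t, 0 <= t <= PI / 2 -> 0 <= remainder2 N K t) /\
  (forall t, 0 <= t <= PI / 2 -> 0 <= remainder1 N K t) /\
  (forall t, 0 <= t <= PI / 2 -> 0 <= remainder N K t <= remainder N K (PI / 2)) /\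
  remainder N K (PI / 2)
  <= (PI / 2) ^ 2 * remainder_end_pred N K + 3 * 2 ^ N * (INR (2 * K + 1) * arcsin_coef K).
Proof.
  induction N as [|N IH]; apply remainder_control_step; intros t ht.
  - simpl; lra.
  - apply IH, ht.
Qed.

Lemma remainder_end_nonneg (N K : nat) : 0 <= remainder N K (PI / 2).
Proof.
  pose proof PI_RGT_0; apply (proj1 (proj2 (proj2 (remainder_control N K)))); lra.
Qed.

(** Induction on [N]: the end value is bounded by multiples of the previous end value and of (2K+1)
    c_K, both tending to 0. *)
Lemma remainder_end_lim (N : nat) : is_lim_seq (fun K => remainder N K (PI / 2)) 0.
Proof.
  assert (hprev : forall N, is_lim_seq (remainder_end_pred N) 0 ->
    is_lim_seq (fun K => remainder N K (PI / 2)) 0).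
  { clear N; intros N hp.
    apply is_lim_seq_le_le with (fun _ => 0)
      (fun K => (PI / 2) ^ 2 * remainder_end_pred N K + 3 * 2 ^ N * (INR (2 * K + 1) * arcsin_coef K)).
    - intros K; split; [apply remainder_end_nonneg|apply remainder_control].
    - apply is_lim_seq_const.
    - replace (Finite 0) with (Finite ((PI / 2) ^ 2 * 0 + 3 * 2 ^ N * 0)) by (f_equal; ring).
      apply is_lim_seq_plus';
        [apply (is_lim_seq_scal_l _ _ (Finite 0)), hp
        |apply (is_lim_seq_scal_l _ _ (Finite 0)), arcsin_coef_lim]. }
  induction N as [|N IH]; apply hprev; [apply is_lim_seq_const|exact IH].
Qed.

(* ((pi/2 - t) R)'' is dominated by (pi/2 - t) R'' + 2 R', whose integral over [0, pi/2] is 3 R(pi/2). *)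
Lemma fourier_remainder_bound (N K k : nat) :
  Rabs (fourier_coef (remainder N K) k)
  <= 3 / 2 * remainder N K (PI / 2) * / INR (k + 1) ^ 2.
Proof.
  destruct (remainder_control N K) as [h2 [h1 _]].
  destruct (trig_freq k) as [hs _]; pose proof (freq_pos k) as hf.
  pose proof PI_RGT_0 as hpi.
  set (f2 := fun t => (PI / 2 - t) * remainder2 N K t - 2 * remainder1 N K t).
  assert (c2 : forall t, continuous f2 t).
  { intros t; apply continuous_Rminus; apply continuous_Rmult;
      auto using continuous_affine, continuous_const, continuous_remainder1, continuous_remainder2. }
  assert (hm : Rabs (sin_moment f2 (freq k)) <= 3 * remainder N K (PI / 2)).
  { apply (norm_RInt_le (fun t => f2 t * sin (freq k * t))
      (fun t => (PI / 2 - t) * remainder2 N K t + 2 * remainder1 N K t) 0 (PI / 2)); [lra| | |].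
    - intros t ht; change (Rabs (f2 t * sin (freq k * t))
        <= (PI / 2 - t) * remainder2 N K t + 2 * remainder1 N K t).
      specialize (h1 t ht); specialize (h2 t ht).
      assert (hb : Rabs (f2 t) <= (PI / 2 - t) * remainder2 N K t + 2 * remainder1 N K t).
      { assert (0 <= (PI / 2 - t) * remainder2 N K t) by (apply Rmult_le_pos; lra).
        unfold f2; apply Rabs_le; lra. }
      assert (hsn : Rabs (sin (freq k * t)) <= 1) by apply Rabs_le, SIN_bound.
      rewrite Rabs_mult; pose proof (Rabs_pos (f2 t)); nra.
    - apply (RInt_correct (fun t => f2 t * sin (freq k * t))), ex_RInt_cont.
      intros t; apply continuous_Rmult; auto using continuous_sin_lin.
    (* The primitive of the dominating function is (pi/2 - t) R' + 3 R. *)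
    - replace (3 * remainder N K (PI / 2)) with
        (minus ((PI / 2 - PI / 2) * remainder1 N K (PI / 2) - (- 3) * remainder N K (PI / 2))
           ((PI / 2 - 0) * remainder1 N K 0 - (- 3) * remainder N K 0)).
      + apply (is_RInt_derive
          (fun t => (PI / 2 - t) * remainder1 N K t - (- 3) * remainder N K t)).
        * intros t _; eapply is_derive_eq.
          -- apply is_derive_R_minus; [apply is_derive_affine_mul, is_derive_remainder1|].
             apply is_derive_scal, is_derive_remainder.
          -- simpl; ring.
        * intros t _; apply continuous_Rplus; apply continuous_Rmult;
            auto using continuous_affine, continuous_const, continuous_remainder1, continuous_remainder2.
      + rewrite remainder_0, remainder1_0.
        match goal with |- minus ?a ?b = _ => change (a - b = 3 * remainder N K (PI / 2)) end; ring. }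
  unfold fourier_coef.
  rewrite (sin_moment_parts _
    (fun t => (PI / 2 - t) * remainder1 N K t - remainder N K t) f2);
    [| | |exact c2|lra|exact hs].
  - rewrite remainder_0.
    replace (2 * _) with (- (2 / freq k ^ 2) * sin_moment f2 (freq k)) by (field; lra).
    rewrite Rabs_mult, Rabs_Ropp, Rabs_pos_eq.
    + apply Rle_trans with (2 / freq k ^ 2 * (3 * remainder N K (PI / 2))).
      * apply Rmult_le_compat_l; [|exact hm].
        apply Rdiv_le_0_compat; [lra|apply pow_lt; lra].
      * apply Req_le; unfold freq; field; apply not_0_INR; lia.
    + apply Rdiv_le_0_compat; [lra|apply pow_lt; lra].
  - intros t; apply is_derive_affine_mul, is_derive_remainder.
  - intros t; eapply is_derive_eq.
    + apply is_derive_R_minus; [apply is_derive_affine_mul, is_derive_remainder1|apply is_derive_remainder].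
    + unfold f2; simpl; ring.
Qed.

(** * Truncation error and closed form *)

Lemma abs_sum_n_le (a b : nat -> R) (n : nat) :
  (forall k, Rabs (a k) <= b k) -> Rabs (sum_n a n) <= sum_n b n.
Proof.
  intros h; induction n as [|n IH]; [rewrite !sum_O; apply h|].
  rewrite !sum_n_R_S; apply Rle_trans with (1 := Rabs_triang _ _), Rplus_le_compat; auto.
Qed.

(** By linearity the difference is the sum of the Fourier coefficients of the remainder; only finite
    sums are interchanged with the series. The constant is 3/2 times the bound 2 on Sum 1/m^2. *)
Lemma truncation_error (N K : nat) :
  Rabs (t_3_twos_value N - sum_n (fun n => / INR (2 * n + 1) ^ 3 * t_twos N n) K)
  <= 3 * remainder N K (PI / 2).
Proof.
  set (A := sum_n (fun n => t_twos N n * / INR (2 * n + 1) ^ 3) K).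
  rewrite (sum_n_R_ext _ (fun n => t_twos N n * / INR (2 * n + 1) ^ 3)) by (intros; ring).
  fold A.
  assert (hs : is_series (fourier_coef (remainder N K)) (1 * t_3_twos_value N + -1 * A)).
  { apply is_series_R_ext with (fun k => 1 * fourier_coef (mono (2 * N + 1)) k
      + -1 * sum_n (fun n => t_twos N n * fourier_coef (sin_term n) k) K).
    - intros k; rewrite <- fourier_coef_sum_n by apply continuous_sin_term.
      rewrite <- fourier_coef_lin;
        [|apply continuous_mono|intros; apply continuous_sum_n; intros; apply continuous_sin_term].
      unfold fourier_coef; f_equal; apply sin_moment_ext; intros t; unfold remainder; ring.
    - apply is_series_R_plus; apply is_series_R_scal; [apply is_series_fourier_mono|].
      apply (is_series_sum_n _ (fun n => fourier_coef (sin_term n))).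
      apply is_series_fourier_sin_term. }
  replace (t_3_twos_value N - A) with (1 * t_3_twos_value N + -1 * A) by ring.
  apply (is_lim_seq_le (fun n => Rabs (sum_n (fourier_coef (remainder N K)) n))
    (fun _ => 3 * remainder N K (PI / 2))
    (Finite (Rabs (1 * t_3_twos_value N + -1 * A))) (Finite (3 * remainder N K (PI / 2)))).
  - intros n; apply Rle_trans with (1 := abs_sum_n_le _ _ n (fourier_remainder_bound N K)).
    rewrite sum_n_R_scal.
    pose proof (sum_inv_sq_le n) as h; pose proof (remainder_end_nonneg N K).
    assert (0 < / INR (n + 1)) by (apply Rinv_0_lt_compat, lt_0_INR; lia).
    nra.
  - apply (is_lim_seq_abs _ (Finite (1 * t_3_twos_value N + -1 * A))), hs.
  - apply is_lim_seq_const.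
Qed.

Lemma mtv_3_twos (N : nat) : mtv (3%nat :: repeat 2%nat N) = Finite (t_3_twos_value N).
Proof.
  apply mtv_eq_lim_even.
  eapply is_lim_seq_ext; [intros K; symmetry; apply mtv_trunc_even|].
  set (A := fun K => sum_n (fun n => / INR (2 * n + 1) ^ 3 * t_twos N n) K).
  apply is_lim_seq_le_le with
    (fun K => t_3_twos_value N - 3 * remainder N K (PI / 2))
    (fun K => t_3_twos_value N + 3 * remainder N K (PI / 2)).
  - intros K; pose proof (truncation_error N K) as h; fold (A K) in h |- *.
    apply Rabs_le_between in h; lra.
  - replace (Finite (t_3_twos_value N)) with (Finite (t_3_twos_value N - 3 * 0)) by (f_equal; ring).
    apply is_lim_seq_minus'; [apply is_lim_seq_const|].
    apply (is_lim_seq_scal_l _ _ (Finite 0)), remainder_end_lim.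
  - replace (Finite (t_3_twos_value N)) with (Finite (t_3_twos_value N + 3 * 0)) by (f_equal; ring).
    apply is_lim_seq_plus'; [apply is_lim_seq_const|].
    apply (is_lim_seq_scal_l _ _ (Finite 0)), remainder_end_lim.
Qed.

Theorem theorem2p8 (N : nat) (hN : (1 <= N)%nat) :
  mtv (3%nat :: repeat 2%nat N) =
  Finite
    (/ 2 ^ (2 * N + 2) *
     (sum_n_m (fun j : nat =>
        (-1) ^ (j + 1) * INR (2 * j) * PI ^ (2 * N + 2 - 2 * j)
          / INR (fact (2 * N + 2 - 2 * j)) * eta (2 * j + 1)) 1 N
      + (-1) ^ N * 2 * INR (2 * N + 2)
          * (1 - powerRZ 2 (- (2 * Z.of_nat N) - 3)) * zeta (2 * N + 3))).
Proof.
  rewrite mtv_3_twos; f_equal; unfold t_3_twos_value.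
  (* Writing N = M+1 splits off the term j = N of the value; the terms j <= M match the stated sum
     at index j+1. *)
  destruct N as [|M]; [lia|].
  rewrite <- sum_n_m_S; fold (sum_n (fun n =>
     (-1) ^ (S n + 1) * INR (2 * S n) * PI ^ (2 * S M + 2 - 2 * S n)
       / INR (fact (2 * S M + 2 - 2 * S n)) * eta (2 * S n + 1)) M).
  rewrite sum_n_R_S, Rmult_plus_distr_l, <- sum_n_R_scal, Rplus_assoc; f_equal.
  - apply sum_n_ext_loc; intros j hj.
    replace (2 * S M + 2 - 2 * S j)%nat with (2 * (S M - j))%nat by lia.
    replace (2 * S j + 1)%nat with (2 * j + 3)%nat by lia.
    replace (S j + 1)%nat with (S (S j)) by lia.
    replace (2 * S M + 2)%nat with (2 * (S M - j) + (2 * j + 2))%nat by lia.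
    replace (2 * j + 3)%nat with (2 * j + 2 + 1)%nat by lia.
    unfold mono, Rdiv; rewrite Rpow_mult_distr, pow_inv, !pow_add, mult_INR, Nat.add_1_r.
    simpl ((-1) ^ S (S j)); simpl (INR 2); simpl (2 ^ 1); simpl (2 ^ 2).
    (* The equality is typed in an abstract carrier; retyping it in R lets [field] apply. *)
    match goal with |- ?a = ?b => change (a = b :> R) end.
    field; repeat split; try (apply pow_nonzero; lra); apply not_0_INR, fact_neq_0.
  (* The term j = N has monomial 1 and joins the zeta term: eta(s) + zeta(s) = 2 (1 - 2^(-s))
     zeta(s) with s = 2N+3. *)
  - unfold eta; rewrite Nat.sub_diag; simpl (2 * 0)%nat; rewrite mono_deg0.
    replace (- (2 * Z.of_nat (S M)) - 3)%Z with (- Z.of_nat (2 * S M + 3))%Z by lia.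
    replace (1 - Z.of_nat (2 * S M + 3))%Z with (- Z.of_nat (2 * S M + 2))%Z by lia.
    rewrite !powerRZ_neg', <- !pow_powerRZ.
    replace (2 ^ (2 * S M + 3)) with (2 ^ (2 * S M + 2) * 2)
      by (replace (2 * S M + 3)%nat with (S (2 * S M + 2)) by lia; simpl; ring).
    replace (INR (2 * S M + 2)) with (2 * INR (S M + 1))
      by (rewrite !plus_INR, mult_INR; simpl (INR 2); simpl (INR 1); ring).
    field; apply pow_nonzero; lra.
Qed.
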